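(* Let $\Gamma$ be a countable group and let $S\leq\Gamma$ be a nontrivial subgroup. Fix a family $(\varepsilon_\gamma)_{\gamma\in\Gamma\setminus\{e_\Gamma\}}$ of real numbers in $]0,1[$ such that $\prod_{\gamma\in\Gamma\setminus\{e_\Gamma\}}(1-\varepsilon_\gamma)>0$, and a family $(n_\gamma)_{\gamma\in\Gamma\setminus\{e_\Gamma\}}$ of pairwise coprime integers. Assume that for every $\gamma\in\Gamma\setminus\{e_\Gamma\}$ there exists a finite index subgroup $\Gamma_\gamma\leq\Gamma$, whose index is a power of $n_\gamma$, such that (1) $\gamma\notin\Gamma_\gamma$, and (2) $\lvert\{q\in\Gamma/\Gamma_\gamma\colon sq=q \text{ for all } s\in S\}\rvert\geq(1-\varepsilon_\gamma)[\Gamma:\Gamma_\gamma]$. For each finite $F\subseteq\Gamma\setminus\{e_\Gamma\}$ let $X_F=\Gamma/\bigcap_{\gamma\in F}\Gamma_\gamma$ with the left-translation action of $\Gamma$ and the uniform probability measure $\mu_F$. Then the profinite action $\Gamma\curvearrowright\varprojlim_F(X_F,\mu_F)$ is allosteric.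
   Context: The finite subsets $F$ of $\Gamma\setminus\{e_\Gamma\}$ are directed by inclusion; for $F\subseteq G$ the map $X_G\to X_F$ is the natural $\Gamma$-equivariant surjection $x\bigcap_{\gamma\in G}\Gamma_\gamma\mapsto x\bigcap_{\gamma\in F}\Gamma_\gamma$. The inverse limit $\varprojlim_F X_F=\{(x_F)\in\prod_F X_F\colon x_F \text{ is the image of } x_G \text{ whenever } F\subseteq G\}$ is a compact metrizable totally disconnected space with the product topology and diagonal $\Gamma$-action, and it carries the unique Borel probability measure $\mu$ whose pushforward to each $X_F$ is $\mu_F$. A minimal ergodic action $\Gamma\curvearrowright(X,\mu)$ (action by homeomorphisms on a compact metric space with all orbits dense, $\mu$ an ergodic invariant Borel probability measure) is allosteric if the set of points with trivial stabilizer is comeager (topologically free) but does not have full $\mu$-measure (not essentially free); in particular the conclusion includes that the action is minimal and ergodic. *)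

(* Defs.v *)
From HB Require Import structures.
From mathcomp Require Import all_boot all_order all_algebra.
From mathcomp Require Import finmap all_classical all_reals all_analysis.

Set Implicit Arguments.
Unset Strict Implicit.
Unset Printing Implicit Defensive.

Import Order.TTheory GRing.Theory Num.Theory.
Local Open Scope classical_set_scope.

Section Profinite.
Variable G : groupType.

Definition is_subgroup (H : set G) : Prop :=
  H 1%g /\ (forall x y, H x -> H y -> H (x * y^-1)%g).

Definition lcoset (g : G) (H : set G) : set G := [set (g * h)%g | h in H].
Definition cosets (H : set G) : set (set G) := [set C | exists g, C = lcoset g H].

Definition subgroup_index (H : set G) (m : nat) : Prop := (cosets H #= `I_m)%card.

Definition S_fixed_cosets (S H : set G) : set (set G) :=
  [set q | cosets H q /\ (forall s, S s -> lcoset s q = q)].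

Definition idx := sig (fun F : {fset G} => is_true (1%g \notin F)).

Variable Gam : G -> set G.

Definition Lam (F : idx) : set G := [set x | forall g, g \in val F -> Gam g x].

(** Points of the inverse limit: compatible families (x_F)_F, x_F in X_F;
    for F included in F', x_F is the image of x_F' under the natural map
    g Lam_F' |-> g Lam_F. *)
Definition inlim (x : idx -> set G) : Prop :=
  (forall F, cosets (Lam F) (x F)) /\
  (forall F F' : idx, (val F `<=` val F')%fset ->
     exists g, x F' = lcoset g (Lam F') /\ x F = lcoset g (Lam F)).

Record Xlim := XL { xval : idx -> set G; xval_lim : inlim xval }.

Lemma lcoset1 (H : set G) : lcoset 1%g H = H.
Proof.
rewrite /lcoset; apply/seteqP; split=> x /=.
  by case=> h Hh <-; rewrite mul1g.
by move=> Hx; exists x => //; rewrite mul1g.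
Qed.

Lemma lcosetM (g h : G) (H : set G) : lcoset g (lcoset h H) = lcoset (g * h)%g H.
Proof.
rewrite /lcoset; apply/seteqP; split=> x /=.
  by case=> y [k Hk <-] <-; exists k => //; rewrite mulgA.
by case=> k Hk <-; exists (h * k)%g; [by exists k | rewrite mulgA].
Qed.

Lemma inlim_pt : inlim (fun F => Lam F).
Proof.
split=> [F|F F' _]; first by exists 1%g; rewrite lcoset1.
by exists 1%g; rewrite !lcoset1.
Qed.

Definition xpt : Xlim := XL inlim_pt.

Lemma inlim_act (g : G) (x : Xlim) : inlim (fun F => lcoset g (xval x F)).
Proof.
case: x => x [H1 H2] /=; split=> [F|F F' FF'].
  by case: (H1 F) => h ->; exists (g * h)%g; rewrite lcosetM.
case: (H2 F F' FF') => h [-> ->]; exists (g * h)%g; by rewrite !lcosetM.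
Qed.

Definition act (g : G) (x : Xlim) : Xlim := XL (inlim_act g x).

(** Product topology (each X_F discrete): basic open sets are the cylinders
    {x | x_F = C}; U is open iff it contains a cylinder around each point. *)
Definition cyl (F : idx) (C : set G) : set Xlim := [set x | xval x F = C].
Definition xopen (U : set Xlim) : Prop :=
  forall x, U x -> exists F : idx, cyl F (xval x F) `<=` U.
Definition xdense (D : set Xlim) : Prop :=
  forall U, xopen U -> U !=set0 -> (D `&` U) !=set0.
Definition xcomeager (A : set Xlim) : Prop :=
  exists D : nat -> set Xlim,
    (forall n, xopen (D n) /\ xdense (D n)) /\ \bigcap_n D n `<=` A.

Definition orbit (x : Xlim) : set Xlim := [set act g x | g in [set: G]].
Definition minimal_action : Prop := forall x, xdense (orbit x).

Definition free_points : set Xlim := [set x | forall g, act g x = x -> g = 1%g].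

End Profinite.

HB.instance Definition _ (G : groupType) (Gam : G -> set G) :=
  gen_eqMixin (Xlim Gam).
HB.instance Definition _ (G : groupType) (Gam : G -> set G) :=
  gen_choiceMixin (Xlim Gam).
HB.instance Definition _ (G : groupType) (Gam : G -> set G) :=
  isPointed.Build (Xlim Gam) (xpt Gam).

Definition XBorel (G : groupType) (Gam : G -> set G) :=
  g_sigma_algebraType (@xopen G Gam).

Section Measure.
Variables (G : groupType) (Gam : G -> set G) (R : realType).
Local Open Scope ring_scope.
Local Open Scope ereal_scope.

Definition has_uniform_marginals (mu : probability (XBorel Gam) R) : Prop :=
  forall (F : idx G) (m : nat), subgroup_index (Lam Gam F) m ->
  forall C, cosets (Lam Gam F) C ->
    mu (@cyl G Gam F C : set (XBorel Gam)) = (m%:R^-1)%:E.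

Definition invariant_measure (mu : probability (XBorel Gam) R) : Prop :=
  forall (g : G) (A : set (XBorel Gam)), measurable A ->
    mu (act g @^-1` A) = mu A.

Definition ergodic (mu : probability (XBorel Gam) R) : Prop :=
  forall A : set (XBorel Gam), measurable A ->
    (forall g : G, act g @^-1` A = A) -> mu A = 0 \/ mu A = 1.

(** Allosteric: minimal, ergodic (invariant) measure, topologically free
    (free points comeager) but not essentially free (free points not of full
    measure, i.e. their complement is not mu-negligible). *)
Definition allosteric (mu : probability (XBorel Gam) R) : Prop :=
  [/\ minimal_action Gam, invariant_measure mu, ergodic mu,
      xcomeager (@free_points G Gam) &
      ~ (mu.-negligible (~` (@free_points G Gam : set (XBorel Gam))))].

End Measure.

(* Main.v *)
(* All orbits are dense because each [X_F] is a transitive [Gamma]-set.  A point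
   [h xpt] is moved by [g <> 1], since [h^-1 g h] avoids the subgroup indexed by
   [h^-1 g h]; such points are dense, so generic points are free.  As the indices
   are pairwise coprime, [X_F] is the product of the [Gamma / Gamma_g], [g] in [F],
   so a proportion at least [prod (1 - eps g) >= c] of [X_F] is fixed by [S];
   continuity from above gives the set of [S]-fixed points measure at least [c].
   Cylinders of the same level have equal measure and are permuted transitively,
   so an invariant set is independent of every cylinder, hence of itself. *)
Require Import Defs.
From HB Require Import structures.
From mathcomp Require Import all_boot all_order all_algebra.
From mathcomp Require Import finmap all_classical all_reals all_analysis.

Import Order.TTheory GRing.Theory Num.Theory.
Local Open Scope classical_set_scope.
Local Open Scope ring_scope.

Lemma card_fsetM (K K' : choiceType) (A : {fset K}) (B : {fset K'}) :
  #|` (A `*` B)%fset| = (#|` A| * #|` B|)%N.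
Proof.
rewrite card_fset_sum1 /fsetM big_imfset2/=; last by move=> [? ?] [? ?] _ _ [-> ->].
under eq_bigr do rewrite sum1_size.
by rewrite big_const_seq count_predT iter_addn_0 mulnC.
Qed.

(** * Cosets, Lagrange's theorem and products of subgroups of coprime index *)

Section Cosets.
#[local] Set Implicit Arguments.
#[local] Unset Strict Implicit.
Context {G : groupType}.
Implicit Types (g h x y : G) (S H K L C D : set G).

Lemma subgroup1 H : is_subgroup H -> H 1%g.
Proof. by case. Qed.

Lemma subgroupV H x : is_subgroup H -> H x -> H x^-1%g.
Proof. by move=> [H1 HV] Hx; rewrite -[_^-1%g]mul1g; exact: HV. Qed.

Lemma subgroupM H x y : is_subgroup H -> H x -> H y -> H (x * y)%g.
Proof.
by move=> sH Hx Hy; rewrite -[y]invgK; apply: sH.2 => //; exact: subgroupV.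
Qed.

Lemma subgroupI H K : is_subgroup H -> is_subgroup K -> is_subgroup (H `&` K).
Proof.
move=> sH sK; split; first by split; exact: subgroup1.
by move=> x y [Hx Kx] [Hy Ky]; split; [exact: sH.2|exact: sK.2].
Qed.

Lemma mem_lcoset H g x : lcoset g H x <-> H (g^-1 * x)%g.
Proof.
split; first by case=> h Hh <-; rewrite mulKg.
by move=> Hx; exists (g^-1 * x)%g => //; rewrite mulVKg.
Qed.

Lemma lcoset_refl H g : is_subgroup H -> lcoset g H g.
Proof. by move=> sH; apply/mem_lcoset; rewrite mulVg; exact: subgroup1. Qed.

Lemma lcoset_id H h : is_subgroup H -> H h -> lcoset h H = H.
Proof.
move=> sH Hh; apply/seteqP; split => x.
  by case=> k Hk <-; exact: subgroupM.
by move=> Hx; apply/mem_lcoset; apply: subgroupM => //; exact: subgroupV.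
Qed.

Lemma lcoset_eqP H g x : is_subgroup H ->
  lcoset g H = lcoset x H <-> H (g^-1 * x)%g.
Proof.
move=> sH; split=> [e|Hx]; first by apply/mem_lcoset; rewrite e; exact: lcoset_refl.
by rewrite -[in RHS](mulVKg g x) -lcosetM (lcoset_id sH Hx).
Qed.

Lemma coset_mem C H x : is_subgroup H -> cosets H C -> C x -> C = lcoset x H.
Proof. by move=> sH [g ->] /mem_lcoset Hx; apply/lcoset_eqP. Qed.

Lemma lcoset_inj g : injective (lcoset g).
Proof.
by move=> C D /(congr1 (lcoset g^-1)%g); rewrite !lcosetM mulVg !lcoset1.
Qed.

Lemma cosets_lcoset H g C : cosets H C -> cosets H (lcoset g C).
Proof. by case=> x ->; exists (g * x)%g; rewrite lcosetM. Qed.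

(** For [L] inside [H] this is the natural projection from cosets of [L] to cosets of [H], written
    without choosing representatives, so that it visibly commutes with translations. *)
Definition coset_hull H C : set G := [set (x * h)%g | x in C & h in H].

Lemma coset_hullE H L g : is_subgroup H -> is_subgroup L -> L `<=` H ->
  coset_hull H (lcoset g L) = lcoset g H.
Proof.
move=> sH sL LH; apply/seteqP; split=> x.
  case=> y [l Ll <-] [h Hh <-]; apply/mem_lcoset.
  by rewrite -mulgA mulKg; apply: subgroupM => //; exact: LH.
case=> h Hh <-; exists g; first exact: lcoset_refl.
by exists h.
Qed.

Lemma coset_hull_lcoset H g C : coset_hull H (lcoset g C) = lcoset g (coset_hull H C).
Proof.
apply/seteqP; split=> x.
  by case=> _ [c Cc <-] [h Hh <-]; exists (c * h)%g; rewrite ?mulgA//; exists c => //; exists h.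
by case=> _ [c Cc [h Hh <-]] <-; exists (g * c)%g; [exists c|exists h => //; rewrite mulgA].
Qed.

Lemma cosets_gt0 H n : subgroup_index H n -> (0 < n)%N.
Proof.
case: n => //; rewrite /subgroup_index II0 card_eq0 => /eqP C0.
have : cosets H (lcoset 1%g H) by exists 1%g.
by rewrite C0.
Qed.

(* Lagrange: a coset of [L] is the translate by a chosen representative of a
   coset of [H] of a coset of [L] inside [H]. *)
Lemma index_dvdn H L a c : is_subgroup H -> is_subgroup L -> L `<=` H ->
  subgroup_index H a -> subgroup_index L c -> (a %| c)%N.
Proof.
move=> sH sL LH Ha Lc.
pose B := [set C | cosets L C /\ C `<=` H].
have finH : finite_set (cosets H) by apply/finite_setP; exists a.
have finL : finite_set (cosets L) by apply/finite_setP; exists c.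
have finB : finite_set B by apply: sub_finite_set finL => C [].
pose r (D : set G) := xget 1%g D.
have rP g : lcoset (r (lcoset g H)) H = lcoset g H.
  apply/esym/coset_mem => //; first by exists g.
  by apply: (@xgetPex _ 1%g (lcoset g H)); exists g; exact: lcoset_refl.
pose f (p : set G * set G) := lcoset (r p.1) p.2.
have fB : set_bij (cosets H `*` B) (cosets L) f.
  split.
  - by move=> [D C] [/= _ [LC _]]; exact: cosets_lcoset.
  - move=> [D C] [D' C'] /[!inE] -[/= [d ->] [[x ->] CH]] [/= [d' ->] [_ CH']].
    rewrite /f/= => e.
    have e1 : lcoset d H = lcoset d' H.
      move: e (rP d) (rP d'); set u := r _; set v := r _ => e ru rv.
      (* The element [u * x] of the common image lies in both [lcoset d H] and [lcoset d' H], which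
         therefore coincide. *)
      have m : lcoset u (lcoset x L) (u * x)%g by exists x => //; exact: lcoset_refl.
      have : lcoset d H (u * x)%g.
        by rewrite -ru; exists x => //; apply: CH; exact: lcoset_refl.
      have : lcoset d' H (u * x)%g.
        by move: m; rewrite e -rv => -[y /CH' Hy <-]; exists y.
      move=> /(coset_mem sH) ->; last by exists d'.
      by move=> /(coset_mem sH); apply; exists d.
    by move: e; rewrite -e1 => /lcoset_inj ->.
  - move=> _ [g ->]; exists (lcoset g H, lcoset ((r (lcoset g H))^-1 * g)%g L).
      split=> /=; first by exists g.
      split; first by exists ((r (lcoset g H))^-1 * g)%g.
      move=> _ [l /LH Hl <-]; apply: subgroupM => //.
      by apply/lcoset_eqP => //; exact: rP.
    by rewrite /f /= lcosetM mulVKg.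
have /(fcard_eq (finite_setX finH finB) finL) : (cosets H `*` B #= cosets L)%card.
  by apply/card_set_bijP; exists f.
rewrite fset_setX// card_fsetM (card_fset_set Ha) (card_fset_set Lc) => <-.
exact: dvdn_mulr.
Qed.

(* Chinese remainder theorem: [C |-> (C H, C K)] is injective, and by coprimality
   of the indices it is a bijection, which moreover is equivariant. *)
Lemma coprime_index_setI S H K a b p q : is_subgroup H -> is_subgroup K ->
  subgroup_index H a -> subgroup_index K b -> coprime a b ->
  (S_fixed_cosets S H #= `I_p)%card -> (S_fixed_cosets S K #= `I_q)%card ->
  subgroup_index (H `&` K) (a * b) /\
  (S_fixed_cosets S (H `&` K) #= `I_(p * q))%card.
Proof.
move=> sH sK Ha Kb cop Hp Kq; have sL := subgroupI sH sK.
set L := H `&` K in sL *.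
have LH : L `<=` H by move=> x [].
have LK : L `<=` K by move=> x [].
have finH : finite_set (cosets H) by apply/finite_setP; exists a.
have finK : finite_set (cosets K) by apply/finite_setP; exists b.
pose f C := (coset_hull H C, coset_hull K C).
have fE g : f (lcoset g L) = (lcoset g H, lcoset g K).
  by rewrite /f !coset_hullE.
have finj : {in cosets L &, injective f}.
  move=> C D /[!inE] -[x ->] [y ->]; rewrite !fE => -[] /lcoset_eqP-/(_ sH) Hxy.
  by move=> /lcoset_eqP-/(_ sK) Kxy; apply/lcoset_eqP.
have fsub : f @` cosets L `<=` cosets H `*` cosets K.
  by move=> _ [_ [g ->] <-]; rewrite fE; split; exists g.
have finf : finite_set (f @` cosets L) by apply: sub_finite_set fsub _; exact: finite_setX.
have fcard : (f @` cosets L #= cosets L)%card by exact: inj_card_eq.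
have finL : finite_set (cosets L) by rewrite -(eq_finite_set fcard).
have [c Lc] : exists c, subgroup_index L c by apply/finite_setP.
have fc : #|` fset_set (f @` cosets L)| = c.
  by apply: card_fset_set; apply: card_eq_trans fcard Lc.
have hk : #|` fset_set (cosets H `*` cosets K)| = (a * b)%N.
  by rewrite fset_setX// card_fsetM (card_fset_set Ha) (card_fset_set Kb).
have fsub' : (fset_set (f @` cosets L) `<=` fset_set (cosets H `*` cosets K))%fset.
  by rewrite -fset_set_sub//; exact: finite_setX.
(* Injectivity of [f] gives [c <= a * b]. By Lagrange both [a] and [b] divide [c > 0], hence so does
   [a * b] by coprimality. *)
have cab : c = (a * b)%N.
  apply/eqP; rewrite eqn_leq -{1}fc -hk fsubset_leq_card//= hk.
  apply: dvdn_leq; first exact: cosets_gt0 Lc.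
  by rewrite Gauss_dvd// (index_dvdn sH sL LH Ha Lc) (index_dvdn sK sL LK Kb Lc).
have fonto : f @` cosets L = cosets H `*` cosets K.
  apply: fset_set_inj; rewrite ?inE//=; first exact: finite_setX.
  by apply/eqP; rewrite -(fsubset_leqif_cards fsub') fc hk cab.
split; first by rewrite -cab.
have fix_onto : f @` S_fixed_cosets S L = S_fixed_cosets S H `*` S_fixed_cosets S K.
  apply/seteqP; split => [_ [C [LC SC] <-]|].
    have [/= HC KC] : (cosets H `*` cosets K) (f C) by rewrite -fonto; exists C.
    by split; split=> //= s Ss; rewrite -coset_hull_lcoset SC.
  (* The preimage of a pair of fixed cosets is fixed, because [f] is injective and commutes with
     translations. *)
  move=> [C D] [/= [HC SC] [KD SD]].
  have : (cosets H `*` cosets K) (C, D) by [].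
  rewrite -fonto => -[E LE fE']; exists E => //; split=> // s Ss.
  apply: finj; rewrite ?inE//; first exact: cosets_lcoset.
  rewrite /f !coset_hull_lcoset; move: fE'; rewrite /f => -[-> ->].
  by rewrite SC // SD.
have : (S_fixed_cosets S L #= f @` S_fixed_cosets S L)%card.
  rewrite card_eq_sym; apply: inj_card_eq => C D /[!inE] -[LC _] [LD _].
  by apply: finj; rewrite inE.
rewrite fix_onto => e; apply: card_eq_trans e _.
have finHp : finite_set (S_fixed_cosets S H) by apply/finite_setP; exists p.
have finKq : finite_set (S_fixed_cosets S K) by apply/finite_setP; exists q.
apply/fcard_eq => //; first exact: finite_setX.
by rewrite fset_setX// card_fsetM (card_fset_set Hp) (card_fset_set Kq) (card_fset_set (card_eqxx _)).
Qed.

End Cosets.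

(** * Index and fixed cosets of finite intersections *)

Section FiniteIntersections.
#[local] Set Implicit Arguments.
#[local] Unset Strict Implicit.
Context {R : realType} {G : groupType} (Gam : G -> set G).

(** Indexing by a sequence allows induction; on the elements of an index [F] it is convertible to
    [Lam Gam F]. *)
Definition seq_meet (s : seq G) : set G := [set x | forall g, g \in s -> Gam g x].

Lemma seq_meet_cons g s : seq_meet (g :: s) = Gam g `&` seq_meet s.
Proof.
apply/seteqP; split=> x /=.
  by move=> h; split; [apply: h; rewrite mem_head|move=> k ks; apply: h; rewrite inE ks orbT].
by move=> [gx sx] k /[!inE] /orP[/eqP->|/sx].
Qed.

Lemma is_subgroup_seq_meet s : (forall g, g \in s -> is_subgroup (Gam g)) ->
  is_subgroup (seq_meet s).
Proof.
move=> sG; split=> [g /sG /subgroup1//|x y sx sy g gs].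
by apply: (sG _ gs).2; [exact: sx|exact: sy].
Qed.

Lemma cosetsT : cosets [set: G] = [set [set: G]].
Proof.
have lT (g : G) : lcoset g [set: G] = setT.
  by apply/seteqP; split=> // x _; apply/mem_lcoset.
apply/seteqP; split=> [_ [g ->]/=|_ ->]; first by rewrite lT.
by exists 1%g; rewrite lT.
Qed.

Lemma S_fixed_cosetsT S : S_fixed_cosets S [set: G] = [set [set: G]].
Proof.
rewrite /S_fixed_cosets cosetsT; apply/seteqP; split=> [C []//|C /= ->].
split=> // s _; apply/seteqP; split=> // x _; exact/mem_lcoset.
Qed.

(** Induction on [s], splitting off one subgroup at a time by [coprime_index_setI]. The last clause
    strengthens the induction: it supplies the coprimality needed to add the next subgroup. *)
Lemma index_seq_meet (S : set G) (eps : G -> R) (n : G -> int) (s : seq G) :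
  (forall g, g <> 1%g -> 0 < eps g < 1) ->
  (forall g h, g <> 1%g -> h <> 1%g -> g <> h -> coprimez (n g) (n h)) ->
  (forall g, g <> 1%g -> is_subgroup (Gam g)) ->
  (forall g, g <> 1%g ->
     exists (m k : nat), subgroup_index (Gam g) m /\ Posz m = n g ^+ k /\
       exists p : nat, (S_fixed_cosets S (Gam g) #= `I_p)%card /\
                       (1 - eps g) * m%:R <= p%:R) ->
  uniq s -> 1%g \notin s ->
  exists m p : nat, [/\ subgroup_index (seq_meet s) m,
    (S_fixed_cosets S (seq_meet s) #= `I_p)%card,
    (\prod_(g <- s) (1 - eps g)) * m%:R <= p%:R &
    forall h, h <> 1%g -> h \notin s -> coprimez (n h) m].
Proof.
move=> eps_range n_coprime Gam_sub Gam_index.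
elim: s => [_ _|g s IH /= /andP[gs us]].
  have -> : seq_meet [::] = setT by apply/seteqP; split.
  exists 1%N, 1%N; split.
  - by rewrite /subgroup_index cosetsT card_set1.
  - by rewrite S_fixed_cosetsT card_set1.
  - by rewrite big_nil mul1r.
  - by move=> h _ _; rewrite coprimezE coprimen1.
rewrite inE negb_or => /andP[/eqP g1 s1].
have {}g1 : g <> 1%g by move=> e; exact: g1.
have {IH}[//|m [p [sm sp le_p cop]]] := IH us.
have [m' [k [gm' [m'E [p' [gp' le_p']]]]]] := Gam_index g g1.
have sgs : is_subgroup (seq_meet s).
  by apply: is_subgroup_seq_meet => h hs; apply: Gam_sub => h1; rewrite -h1 hs in s1.
have cmm' : coprime m' m.
  have : coprimez m' m by rewrite m'E; apply: coprimezXl; exact: cop.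
  by rewrite coprimezE.
have [Hm Hp] := coprime_index_setI (Gam_sub g g1) sgs gm' sm cmm' gp' sp.
exists (m' * m)%N, (p' * p)%N; rewrite seq_meet_cons; split => //.
- rewrite big_cons !natrM mulrACA; apply: ler_pM => //.
    by rewrite mulr_ge0// subr_ge0; have /andP[_ /ltW] := eps_range g g1.
  rewrite mulr_ge0// big_seq prodr_ge0// => h hs.
  have h1 : h <> 1%g by move=> h1; rewrite -h1 hs in s1.
  by rewrite subr_ge0; have /andP[_ /ltW] := eps_range h h1.
- move=> h h1; rewrite inE negb_or => /andP[/eqP hg hs].
  rewrite PoszM coprimezMr cop// m'E andbT; apply: coprimezXr.
  exact: n_coprime.
Qed.

End FiniteIntersections.

(** * Topology of the inverse limit: minimality and topological freeness *)

Section InverseLimit.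
#[local] Set Implicit Arguments.
#[local] Unset Strict Implicit.
Context {G : groupType} {Gam : G -> set G}.
Hypothesis Gam_sub : forall g, g <> 1%g -> is_subgroup (Gam g).
Local Notation X := (Xlim Gam).
Implicit Types (F : idx G) (x y : X).

Definition mk_idx (F : {fset G}) (F1 : 1%g \notin F) : idx G :=
  exist (fun F : {fset G} => is_true (1%g \notin F)) F F1.

Lemma mem_idx_neq1 F g : g \in val F -> g <> 1%g.
Proof. by case: F => F F1 /= gF g1; move: F1; rewrite -g1 gF. Qed.

Lemma LamE F : Lam Gam F = seq_meet Gam (val F).
Proof. by []. Qed.

Lemma is_subgroup_Lam F : is_subgroup (Lam Gam F).
Proof.
rewrite LamE; apply: is_subgroup_seq_meet => g gF.
by apply: Gam_sub; exact: (@mem_idx_neq1 F).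
Qed.

(** Compatibility represents both coordinates of a point by one group element, and [Lam Gam F'] is
    contained in [Lam Gam F]; so a finer coordinate determines a coarser one. *)
Lemma xval_sub F F' x y : (val F `<=` val F')%fset ->
  xval x F' = xval y F' -> xval x F = xval y F.
Proof.
move=> FF'; have [g [-> ->]] := (xval_lim x).2 F F' FF'.
have [h [-> ->]] := (xval_lim y).2 F F' FF'.
move=> /(lcoset_eqP _ _ (is_subgroup_Lam F')) gh.
apply/(lcoset_eqP _ _ (is_subgroup_Lam F)) => k kF; apply: gh.
exact: (fsubsetP FF').
Qed.

Lemma Xlim_ext x y : (forall F, xval x F = xval y F) -> x = y.
Proof.
case: x y => [x px] [y py] /= /funext xy; move: px py; rewrite xy => px py.
by congr XL; exact: Prop_irrelevance.
Qed.

Lemma act_xpt F x : exists g, xval (act g (xpt Gam)) F = xval x F.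
Proof. by have [g e] := (xval_lim x).1 F; exists g => /=; rewrite e. Qed.

Lemma xopen_cyl F C : xopen (@cyl G Gam F C).
Proof. by move=> x <-; exists F. Qed.

Lemma preimage_act_cyl F C g : act g @^-1` cyl F C = @cyl G Gam F (lcoset g^-1%g C).
Proof.
apply/seteqP; split=> x /=; rewrite /cyl/=; first by move<-; rewrite lcosetM mulVg lcoset1.
by move->; rewrite lcosetM mulgV lcoset1.
Qed.

Lemma xopen_preimage_act g (U : set X) : xopen U -> xopen (act g @^-1` U).
Proof.
move=> oU x /= /oU[F FU]; exists F => y; rewrite /cyl/= => xy.
by apply: FU; rewrite /cyl/= xy.
Qed.

Lemma Xlim_minimal : minimal_action Gam.
Proof.
move=> x U oU [y /oU[F FU]].
have [g gE] := (xval_lim x).1 F; have [h hE] := (xval_lim y).1 F.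
(* This element carries the coset of [g] to the coset of [h] at level [F]. *)
exists (act (h * g^-1)%g x); split; first by exists (h * g^-1)%g.
by apply: FU; rewrite /cyl/= gE hE lcosetM mulgVK.
Qed.

(** If [g] moves [x], it already moves some coordinate of [x], hence every point of the cylinder
    through that coordinate. *)
Lemma xopen_moved g : xopen [set x : X | act g x <> x].
Proof.
move=> x /= gx; have [F gxF] : exists F, lcoset g (xval x F) <> xval x F.
  by apply: contrapT => /forallNP h; apply: gx; apply: Xlim_ext => F /=; exact: contrapT.
by exists F => y; rewrite /cyl/= => yx gy; apply: gxF; rewrite -yx -[in RHS]gy.
Qed.

(* Near [x] there is a translate [h xpt] of the base point; its stabilizer misses
   [g] because [h^-1 g h] is not in the subgroup indexed by that very element. *)
Lemma xdense_moved g : (forall g, g <> 1%g -> ~ Gam g g) -> g <> 1%g ->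
  xdense [set x : X | act g x <> x].
Proof.
move=> Gam_notin g1 U oU [x /oU[F FU]].
have [h hE] := act_xpt F x.
exists (act h (xpt Gam)); split; last exact: FU.
pose k := (h^-1 * g * h)%g.
have k1 : k <> 1%g.
  move=> e; apply: g1; move: e => /(congr1 (fun z => h * z * h^-1)%g).
  by rewrite /k !mulgA mulgV mul1g mulgK mulg1 mulgV.
have kF : 1%g \notin [fset k]%fset by rewrite inE; apply/eqP => /esym.
(* If [g] fixed the point, its coordinate at the singleton index of [k] would give [Gam k k]. *)
move=> /(congr1 (fun y => xval y (mk_idx kF))) /=.
rewrite lcosetM => /esym /(lcoset_eqP _ _ (is_subgroup_Lam _)) /(_ k).
by rewrite mulgA inE => /(_ (eqxx _)); exact: Gam_notin.
Qed.

Lemma xcomeager_free_points : countable [set: G] ->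
  (forall g, g <> 1%g -> ~ Gam g g) -> xcomeager (@free_points G Gam).
Proof.
move=> /countable_injP[f finj] Gam_notin.
(* The dense open sets are numbered by the codes [f g]. Injectivity of [f] leaves at most one
   element to be handled for each [n]. *)
exists (fun n => [set x : X | forall g, f g = n -> g <> 1%g -> act g x <> x]); split.
  move=> n; have [[g [gn g1]]|ng] := pselect (exists g, f g = n /\ g <> 1%g).
    have -> : [set x : X | forall h, f h = n -> h <> 1%g -> act h x <> x] =
              [set x : X | act g x <> x].
      apply/seteqP; split=> x /= gx; first exact: gx.
      move=> h hn _; suff -> : h = g by [].
      by apply: finj; rewrite ?inE// hn.
    by split; [exact: xopen_moved|exact: xdense_moved].
  (* Here [n] codes no nontrivial element and the condition is vacuous. *)
  have -> : [set x : X | forall h, f h = n -> h <> 1%g -> act h x <> x] = setT.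
    by apply/seteqP; split=> // x _ /= h hn h1; case: ng; exists h.
  split=> [x _|U oU [x Ux]]; last by exists x.
  have F1 : 1%g \notin (fset0 : {fset G}) by rewrite inE.
  by exists (mk_idx F1).
move=> x xD g gx; apply: contrapT => g1; exact: (xD (f g)).
Qed.

End InverseLimit.

(** * Measure on the inverse limit: invariance, ergodicity, points fixed by [S] *)

Section InverseLimitMeasure.
#[local] Set Implicit Arguments.
#[local] Unset Strict Implicit.
Context {R : realType} {G : groupType} {Gam : G -> set G}.
Hypothesis Gam_sub : forall g, g <> 1%g -> is_subgroup (Gam g).
Hypothesis index_finite : forall F : idx G, exists m, subgroup_index (Lam Gam F) m.
Variable Fs : nat -> idx G.
Hypothesis Fs_homo : forall i j, (i <= j)%N -> (val (Fs i) `<=` val (Fs j))%fset.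
Hypothesis Fs_cofinal : forall F : idx G, exists i, (val F `<=` val (Fs i))%fset.
Local Notation X := (XBorel Gam).

Lemma finite_cosets F : finite_set (cosets (Lam Gam F)).
Proof. exact/finite_setP/index_finite. Qed.

Lemma measurable_xopen (U : set X) : xopen U -> measurable U.
Proof. exact: sub_sigma_algebra. Qed.

Lemma measurable_cyl F C : measurable (@cyl G Gam F C : set X).
Proof. by apply: measurable_xopen; exact: xopen_cyl. Qed.

Lemma measurable_act g : measurable_fun [set: X] (act g : X -> X).
Proof.
apply: (@measurability _ _ X X setT _ (@xopen G Gam)) => //.
by move=> _ [U oU <-]; rewrite setTI; apply: measurable_xopen; exact: xopen_preimage_act.
Qed.

(** A generating class closed under intersection. Restricting to the chain [Fs] makes any two levels
    comparable; [setT] is included to provide the cover required by uniqueness of measures. *)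
Definition cylinders : set (set X) :=
  [set A | A = setT \/ exists i C, A = @cyl G Gam (Fs i) C].

Lemma cyl_notin_cosets F C : ~ cosets (Lam Gam F) C -> @cyl G Gam F C = set0.
Proof.
move=> FC; rewrite -subset0 => x xC; apply: FC.
by rewrite -xC; exact: (xval_lim x).1.
Qed.

(** Along the chain, cylinders are nested or disjoint, since the coordinate at [Fs j] determines the
    one at [Fs i]. *)
Lemma cylI i j C D : (i <= j)%N -> cylinders (@cyl G Gam (Fs i) C `&` cyl (Fs j) D).
Proof.
move=> ij; right; exists j.
have [[x [xC xD]]|] := pselect (@cyl G Gam (Fs i) C `&` cyl (Fs j) D !=set0).
  exists D; apply/seteqP; split=> [y []//|y yD]; split=> //.
  by rewrite /cyl/= -xC; apply: (xval_sub Gam_sub (Fs_homo ij)); rewrite yD.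
(* The empty set is not a coset, so the cylinder over it is empty. *)
move=> /set0P/negP/negPn/eqP ->; exists set0; rewrite cyl_notin_cosets// => -[g].
by move=> /seteqP[_ /(_ g (lcoset_refl g (is_subgroup_Lam Gam_sub _)))].
Qed.

Lemma setI_closed_cylinders : setI_closed cylinders.
Proof.
move=> A B [->|[i [C ->]]]; first by rewrite setTI.
move=> [->|[j [D ->]]]; first by rewrite setIT; right; exists i, C.
by have [ij|/ltnW ji] := leqP i j; [exact: cylI|rewrite setIC; exact: cylI].
Qed.

Lemma measurable_cylinders : (measurable : set (set X)) = <<s cylinders >>.
Proof.
apply/seteqP; split; apply: smallest_sub.
- exact: smallest_sigma_algebra.
- move=> U oU.
  (* By cofinality an open set is the union of the chain cylinders it contains, finitely many at
     each level. *)
  have -> : U = \bigcup_i \bigcup_(C in [set C | cosets (Lam Gam (Fs i)) C /\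
      cyl (Fs i) C `<=` U]) @cyl G Gam (Fs i) C.
    apply/seteqP; split=> [x /oU[F FU]|x [i _ [C [_ CU] /CU//]]].
    have [i Fi] := Fs_cofinal F; exists i => //; exists (xval x (Fs i)) => //.
    split; first exact: (xval_lim x).1.
    by move=> y yx; apply: FU; exact: (xval_sub Gam_sub Fi).
  apply: (@bigcupT_measurable _ (g_sigma_algebraType cylinders)) => i.
  apply: fin_bigcup_measurable; first by apply: sub_finite_set (finite_cosets (Fs i)) => C [].
  by move=> C _; apply: sub_sigma_algebra; right; exists i, C.
- exact: (sigma_algebra_measurable X).
- by move=> _ [->|[i [C ->]]]; [exact: measurableT|exact: measurable_cyl].
Qed.

Lemma measure_eq_cyl (m1 m2 : {measure set X -> \bar R}) :
  (m1 setT < +oo)%E -> m1 setT = m2 setT ->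
  (forall F C, cosets (Lam Gam F) C -> m1 (cyl F C) = m2 (cyl F C)) ->
  forall A, measurable A -> m1 A = m2 A.
Proof.
move=> m1oo m12T m12; apply: (measure_unique cylinders (fun=> setT)) => //.
- exact: measurable_cylinders.
- exact: setI_closed_cylinders.
- by move=> _; left.
- by rewrite bigcup_const.
- move=> _ [->//|[i [C ->]]].
  have [/m12//|/cyl_notin_cosets ->] := pselect (cosets (Lam Gam (Fs i)) C).
  by rewrite !measure0.
Qed.

Lemma trivIset_cyl F (D : set (set G)) (A : set X) :
  trivIset D (fun C => @cyl G Gam F C `&` A).
Proof. by move=> C C' _ _ [x [[<- _] [<- _]]]. Qed.

(** The parameter [A] serves two uses: an invariant set for ergodicity, and [setT] for counting
    fixed cosets. *)
Lemma measure_cyl_const (mu : {measure set X -> \bar R}) (A : set X) F D p (r : \bar R) :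
  measurable A -> (D #= `I_p)%card ->
  (forall C, D C -> mu (cyl F C `&` A) = r) ->
  mu (\bigcup_(C in D) (@cyl G Gam F C `&` A)) = (p%:R%:E * r)%E.
Proof.
move=> mA Dp Dr; have finD : finite_set D by apply/finite_setP; exists p.
rewrite measure_fin_bigcup//; last 2 first.
- exact: trivIset_cyl.
- by move=> C _; apply: measurableI => //; exact: measurable_cyl.
rewrite (eq_fsbigr (fun=> r)); last by move=> C /[!inE] /Dr.
rewrite fsbig_finite//= big_const_seq count_predT (card_fset_set Dp).
by rewrite mule_natl; elim: (p) => //= -[|k] ->; rewrite ?addr0.
Qed.

Context (mu : probability X R) (mu_unif : has_uniform_marginals mu).

(** The pushforward of [mu] agrees with [mu] on cylinders, as translation permutes the equally
    weighted cosets of each level. *)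
Lemma Xlim_invariant : invariant_measure mu.
Proof.
move=> g A mA.
pose nu : {measure set X -> \bar R} :=
  measure_function_pushforward__canonical__measure_function_Measure mu (measurable_act g).
have nuE B : nu B = mu (act g @^-1` B) by [].
rewrite -nuE; apply: measure_eq_cyl mA.
- by rewrite nuE preimage_setT probability_setT ltry.
- by rewrite nuE preimage_setT.
- move=> F C FC; rewrite nuE preimage_act_cyl.
  have [m Fm] := index_finite F.
  exact: etrans (mu_unif Fm (cosets_lcoset g^-1%g FC)) (esym (mu_unif Fm FC)).
Qed.

Lemma invariant_setI_cyl (A : set X) : measurable A ->
  (forall g : G, act g @^-1` A = A) -> forall F C, cosets (Lam Gam F) C ->
  mu (cyl F C `&` A) = (mu A * mu (cyl F C))%E.
Proof.
move=> mA gA F C FC; have [m Fm] := index_finite F.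
have mC D : cosets (Lam Gam F) D -> mu (cyl F D `&` A) = mu (cyl F C `&` A).
  case: FC => g -> [h ->].
  rewrite -(@Xlim_invariant (g * h^-1)%g (cyl F (lcoset g _) `&` A)); last first.
    by apply: measurableI => //; exact: measurable_cyl.
  by rewrite preimage_setI gA preimage_act_cyl lcosetM invgM invgK mulgVK.
(* The [m] cylinders of level [F] cut [A] into slices of equal mass, while each cylinder has mass
   [1/m]. *)
have : mu A = (m%:R%:E * mu (cyl F C `&` A))%E.
  rewrite -(measure_cyl_const mA Fm mC); congr (mu _).
  apply/seteqP; split=> [x Ax|x [D _ []]//]; exists (xval x F) => //.
  exact: (xval_lim x).1.
move=> ->; rewrite (mu_unif Fm)// -muleAC -EFinM mulfV ?mul1e//.
by rewrite pnatr_eq0 -lt0n; exact: cosets_gt0 Fm.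
Qed.

(** The restriction of [mu] to [A] and [mu] scaled by [mu A] agree on cylinders, hence everywhere.
    Evaluating at [A] shows that [mu A] equals its square. *)
Lemma Xlim_ergodic : ergodic mu.
Proof.
move=> A mA gA.
have finA : mu A \is a fin_num by exact: fin_num_measure.
have A0 : 0 <= fine (mu A) by rewrite fine_ge0.
pose m2 : {measure set X -> \bar R} := mscale (NngNum A0) mu.
have m2E B : m2 B = (mu A * mu B)%E by rewrite /m2/= /mscale/= fineK.
have e : mu A = (mu A * mu A)%E.
  rewrite -{1}(setIid A) -m2E.
  apply: (@measure_eq_cyl (mrestr mu mA) m2) => //.
  - by rewrite /= /mrestr setTI; rewrite ltey_eq finA.
  - by rewrite m2E /= /mrestr setTI probability_setT mule1.
  - by move=> F C FC; rewrite m2E /= /mrestr; exact: invariant_setI_cyl.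
move: e; rewrite -(fineK finA) -EFinM => -[] /eqP.
rewrite -{1}[fine _]mulr1 -subr_eq0 -mulrBr mulf_eq0 subr_eq0 => /orP[/eqP->|/eqP <-].
  by left.
by right.
Qed.

Lemma fixed_not_negligible (S : set G) (c : R) :
  (exists s, S s /\ s <> 1%g) -> 0 < c ->
  (forall F, exists m p : nat, [/\ subgroup_index (Lam Gam F) m,
     (S_fixed_cosets S (Lam Gam F) #= `I_p)%card & c * m%:R <= p%:R]) ->
  ~ mu.-negligible (~` (@free_points G Gam : set X)).
Proof.
move=> [s [Ss s1]] c0 fixc neg.
pose fixF F : set X := [set x | S_fixed_cosets S (Lam Gam F) (xval x F)].
have fixFE F : fixF F = \bigcup_(C in S_fixed_cosets S (Lam Gam F)) (@cyl G Gam F C `&` setT).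
  by apply/seteqP; split=> [x xF|x [C CS [xC _]]]; [exists (xval x F)|rewrite /fixF/= xC].
have mfixF F : measurable (fixF F).
  rewrite fixFE; apply: fin_bigcup_measurable.
    by apply: sub_finite_set (finite_cosets F) => C [].
  by move=> C _; rewrite setIT; exact: measurable_cyl.
have mu_fixF F : (c%:E <= mu (fixF F))%E.
  have [m [p [Fm Fp cmp]]] := fixc F.
  rewrite fixFE (measure_cyl_const (r := (m%:R^-1)%:E) measurableT Fp).
    by rewrite -EFinM lee_fin ler_pdivlMr// ltr0n; exact: cosets_gt0 Fm.
  by move=> C [FC _]; rewrite setIT; exact: mu_unif.
pose fixI := \bigcap_i fixF (Fs i).
have mfixI : measurable fixI by apply: bigcap_measurableType.
have cfix : (c%:E <= mu fixI)%E.
  (* Continuity from above: being fixed at a finer level forces being fixed at a coarser one, so the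
     sets decrease. *)
  have : mu \o (fixF \o Fs) @ \oo --> mu fixI.
    apply: nonincreasing_cvg_mu => //.
    - by rewrite ltey_eq fin_num_measure//; exact: mfixF.
    - by move=> i; exact: mfixF.
    - move=> i j ij; apply/subsetPset => x [_ xS]; split; first exact: (xval_lim x).1.
      move=> t /xS tx; apply: (@xval_sub _ _ Gam_sub _ _ (act t x) x (Fs_homo ij)).
      exact: tx.
  move=> h; rewrite -(cvg_lim _ h)//; apply: lime_ge; first by apply/cvg_ex; eexists; exact: h.
  by apply: nearW => i; exact: mu_fixF.
have : mu fixI = 0%E.
  (* A point of [fixI] is fixed by [s <> 1] at every level of the cofinal chain, hence in every
     coordinate, so it is not free. *)
  apply: measure_negligible => //; apply: negligibleS neg => x xI /= /(_ s) xs.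
  apply: s1; apply: xs; apply: Xlim_ext => F.
  have [i Fi] := Fs_cofinal F; apply: (xval_sub Gam_sub Fi).
  by have [_] := xI i I; exact.
by move=> e; move: cfix; rewrite e lee_fin leNgt c0.
Qed.

End InverseLimitMeasure.

(** * A cofinal chain of indices, and the assembly of the theorem *)

Lemma idx_exhaustion (G : groupType) : countable [set: G] ->
  exists2 Fs : nat -> idx G,
    forall i j, (i <= j)%N -> (val (Fs i) `<=` val (Fs j))%fset &
    forall F : idx G, exists i, (val F `<=` val (Fs i))%fset.
Proof.
move=> /countable_injP[f finj].
pose A i := [set g : G | g <> 1%g /\ (f g < i)%N].
have finA i : finite_set (A i).
  apply: (@sub_finite_set _ _ (f @^-1` `I_i)); first by move=> g [].
  by apply: finite_preimage => // g h _ _; apply: finj; rewrite inE.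
have A1 i : 1%g \notin fset_set (A i).
  by rewrite in_fset_set// notin_setE => -[].
exists (fun i => mk_idx (A1 i)) => [i j ij|F]; rewrite /=.
  rewrite -fset_set_sub// => g [g1 gi]; split=> //; exact: leq_trans gi ij.
(* The successor is taken because [A i] bounds codes strictly. *)
exists (\max_(g <- val F) f g).+1; apply/fsubsetP => g gF.
rewrite in_fset_set// inE; split; first exact: mem_idx_neq1 gF.
by rewrite ltnS (big_rem g)//= leq_maxl.
Qed.

Theorem theorem3p2 (R : realType) (G : groupType)
  (G_countable : countable [set: G])
  (S : set G) (S_sub : is_subgroup S) (S_nontriv : exists s, S s /\ s <> 1%g)
  (eps : G -> R)
  (eps_range : forall g, g <> 1%g -> 0 < eps g < 1)
  (eps_prod : exists2 c : R, 0 < c &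
     forall F : {fset G}, 1%g \notin F -> c <= \prod_(g <- F) (1 - eps g))
  (n : G -> int)
  (n_coprime : forall g h, g <> 1%g -> h <> 1%g -> g <> h -> coprimez (n g) (n h))
  (Gam : G -> set G)
  (Gam_sub : forall g, g <> 1%g -> is_subgroup (Gam g))
  (Gam_index : forall g, g <> 1%g ->
     exists (m k : nat), subgroup_index (Gam g) m /\ Posz m = n g ^+ k /\
       exists p : nat, (S_fixed_cosets S (Gam g) #= `I_p)%card /\
                       (1 - eps g) * m%:R <= p%:R)
  (Gam_notin : forall g, g <> 1%g -> ~ Gam g g) :
  forall mu : probability (XBorel Gam) R,
    has_uniform_marginals mu -> allosteric mu.
Proof.
move=> mu mu_unif.
have [c c0 c_le] := eps_prod.
(* Bounding every finite product below by [c] makes the proportion of fixed cosets uniform in [F],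
   which is what survives in the limit. *)
have index_Lam F : exists m p : nat, [/\ subgroup_index (Lam Gam F) m,
    (S_fixed_cosets S (Lam Gam F) #= `I_p)%card & c * m%:R <= p%:R].
  have F1 : 1%g \notin val F by case: F.
  have [m [p [Fm Fp le_p _]]] :=
    index_seq_meet eps_range n_coprime Gam_sub Gam_index (fset_uniq (val F)) F1.
  exists m, p; split => //; apply: le_trans le_p.
  by rewrite ler_wpM2r//; exact: c_le.
have index_finite F : exists m, subgroup_index (Lam Gam F) m.
  by have [m [p []]] := index_Lam F; exists m.
have [Fs Fs_homo Fs_cofinal] := idx_exhaustion _ G_countable.
split.
- exact: Xlim_minimal.
- exact: (Xlim_invariant Gam_sub index_finite Fs_homo Fs_cofinal mu_unif).
- exact: (Xlim_ergodic Gam_sub index_finite Fs_homo Fs_cofinal mu_unif).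
- exact: xcomeager_free_points.
- exact: (fixed_not_negligible Gam_sub index_finite Fs_homo Fs_cofinal mu_unif S_nontriv c0).
Qed.
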